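(* Let $p,q,\ell,n$ be positive integers with $p\le q\le \ell$ and $\gcd(p,q,\ell)=1$. Let $N(p,q,\ell,n)$ denote the number of ordered triples $(x,y,z)$ of nonnegative integers with $px+qy+\ell z=n$. Let $u=\gcd(p,q)$ and $A=\{p/u,\,q/u\}$. Then \[ N(p,q,\ell,n)=\sum_{k=0}^{\left\lfloor \frac{n-j\ell}{u\ell}\right\rfloor} p_A\!\left(\frac{n-j\ell}{u}-\ell k\right), \] where $j\in\{0,1,\ldots,u-1\}$ satisfies $n-\ell j\equiv 0 \pmod u$ (an empty sum being $0$).
   Context: For a set $A=\{a,b\}$ of relatively prime positive integers and an integer $m\ge 0$, $p_A(m)$ denotes the number of partitions of $m$ with all parts in $A$, i.e. the number of pairs $(x,y)$ of nonnegative integers with $ax+by=m$. *)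

(* Defs.v *)
From mathcomp Require Import all_boot all_order all_algebra.

Set Implicit Arguments.
Unset Strict Implicit.
Unset Printing Implicit Defensive.

(* Positive coefficients force every coordinate of a solution to be at most
   the right-hand side, so the finite types below omit no solution. *)

Definition N (p q l n : nat) : nat :=
  #|[set t : 'I_n.+1 * 'I_n.+1 * 'I_n.+1
     | p * t.1.1 + q * t.1.2 + l * t.2 == n]|.

(* The right-hand side is an integer because it arises from a subtraction;
   the value is 0 when m < 0.  For a = b the pairs (x, y) are still counted
   as ordered pairs. *)
Definition pA (a b : nat) (m : int) : nat :=
  #|[set t : 'I_`|m|.+1 * 'I_`|m|.+1 | Posz (a * t.1 + b * t.2) == m]|.

Definition sum_upto (F : int) (f : nat -> nat) : nat :=
  if F is Posz m then \sum_(0 <= k < m.+1) f k else 0.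

Lemma solution_bound (p q l n x y z : nat) :
  0 < p -> 0 < q -> 0 < l -> p * x + q * y + l * z = n ->
  [/\ x < n.+1, y < n.+1 & z < n.+1].
Proof.
move=> p0 q0 l0 <-; rewrite !ltnS; split.
- by rewrite -addnA (leq_trans (leq_pmull x p0)) ?leq_addr.
- by rewrite addnAC (leq_trans (leq_pmull y q0)) ?leq_addl.
- by rewrite (leq_trans (leq_pmull z l0)) ?leq_addl.
Qed.

(* Main.v *)
Require Import Defs.
From mathcomp Require Import all_boot all_order all_algebra.
From mathcomp Require Import zify.

(** Sort the solutions of [p x + q y + l z = n] by [z]. The equation
    [p x + q y = n - l z] is solvable only if [u = gcd(p, q)] divides
    [n - l z]; as [u] and [l] are coprime this means [z = j + u k], and dividing
    by [u] turns it into [(p/u) x + (q/u) y = (n - j l)/u - l k]. *)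

(* The box size [B] is kept apart from [m] so that counts over the different
   boxes used by [N] and [pA] can be compared. *)
Definition box_count (a b B m : nat) : nat :=
  \sum_(x < B) \sum_(y < B) (a * x + b * y == m).

(** With positive coefficients a coordinate above [m] makes the left side exceed [m], so the
    enlarged box adds only zero terms. *)
Lemma box_count_widen (a b B m : nat) :
  0 < a -> 0 < b -> m < B -> box_count a b B m = box_count a b m.+1 m.
Proof.
move=> a0 b0 mB; rewrite /box_count.
rewrite [RHS](big_ord_widen B (fun x => \sum_(y < m.+1) (a * x + b * y == m)))//.
rewrite [RHS]big_mkcond /=; apply: eq_bigr => x _; case: ifP => xm.
  rewrite [RHS](big_ord_widen B (fun y => nat_of_bool (a * x + b * y == m)))//.
  rewrite [RHS]big_mkcond /=; apply: eq_bigr => y _; case: ifP => // ym.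
  by apply/eqP; rewrite eqb0; nia.
by rewrite big1 // => y _; apply/eqP; rewrite eqb0; nia.
Qed.

Lemma box_count_scale (u a b B m : nat) :
  0 < u -> box_count (u * a) (u * b) B (u * m) = box_count a b B m.
Proof.
move=> u0; apply: eq_bigr => x _; apply: eq_bigr => y _.
by rewrite -!mulnA -mulnDr eqn_pmul2l.
Qed.

Lemma box_count_ndvd (u a b B m : nat) :
  u %| a -> u %| b -> ~~ (u %| m) -> box_count a b B m = 0.
Proof.
move=> ua ub um; rewrite /box_count big1 // => x _; rewrite big1 // => y _.
apply/eqP; rewrite eqb0; apply: contra um => /eqP <-.
by rewrite dvdn_add // dvdn_mulr.
Qed.

Lemma pA_box_count (a b m : nat) : pA a b (Posz m) = box_count a b m.+1 m.
Proof.
rewrite /pA /box_count cardsE -sum1_card pair_big_dep /= [LHS]big_mkcond /=.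
by apply: eq_bigr => -[x y] _; rewrite unfold_in.
Qed.

(** The guard [l * z <= n] is essential: otherwise the truncated [n - l * z] would be 0 and count
    the spurious solution [x = y = 0]. *)
Lemma N_sum (p q l n : nat) :
  N p q l n =
  \sum_(z < n.+1 | l * z <= n) box_count p q n.+1 (n - l * z).
Proof.
transitivity (\sum_(z < n.+1) \sum_(x < n.+1) \sum_(y < n.+1)
                (p * x + q * y + l * z == n : nat)).
  rewrite /N cardsE -sum1_card [LHS]big_mkcond /=.
  under [RHS]eq_bigr => z _ do rewrite pair_big_dep /=.
  rewrite exchange_big pair_big_dep /=.
  by apply: eq_bigr => -[[x y] z] _; rewrite unfold_in.
rewrite [RHS]big_mkcond /=; apply: eq_bigr => z _; case: ifP => lz.
  by apply: eq_bigr => x _; apply: eq_bigr => y _; congr nat_of_bool; lia.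
by rewrite big1 // => x _; rewrite big1 // => y _; apply/eqP; rewrite eqb0; lia.
Qed.

Lemma eqn_mod_mul2l (u l y z : nat) :
  coprime u l -> (l * y == l * z %[mod u]) = (y == z %[mod u]).
Proof.
move=> ul; wlog zy : y z / z <= y => [hw|].
  by have [/hw//|/ltnW/hw] := leqP z y; rewrite eq_sym [RHS]eq_sym.
by rewrite !eqn_mod_dvd ?leq_mul2l ?zy ?orbT // -mulnBr Gauss_dvdr.
Qed.

Lemma dvdn_sub_mod (u l n j z : nat) :
  coprime u l -> j * l = n %[mod u] -> l * z <= n ->
  (u %| n - l * z) = (z == j %[mod u]).
Proof.
move=> ul jn zn.
by rewrite -(eqn_mod_dvd _ zn) -jn mulnC eqn_mod_mul2l // eq_sym.
Qed.

(** The Chinese remainder theorem gives a multiple of [l] congruent to [n] modulo [u]; its quotient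
    by [l], reduced modulo [u], is the witness. *)
Lemma mod_solution (u l n : nat) :
  0 < u -> coprime u l -> exists2 j, j < u & j * l = n %[mod u].
Proof.
move=> u0 ul; pose x := chinese u l n 0.
have lx : l %| x by rewrite /dvdn /x (chinese_modr ul) mod0n.
exists ((x %/ l) %% u); first exact: ltn_pmod.
by rewrite modnMml divnK // /x (chinese_modl ul).
Qed.

(** Passes from integers to naturals without assuming [b <= a], since [d j] may be negative. *)
Lemma dvdz_sub_mod (u a b : nat) :
  ((a%:Z - b%:Z)%R = 0 %[mod u])%Z <-> b = a %[mod u].
Proof.
rewrite mod0z; split=> [/dvdz_mod0P | ba]; last apply/dvdz_mod0P.
  by rewrite -eqz_mod_dvd !modz_nat => /eqP[].
by rewrite -eqz_mod_dvd !modz_nat ba.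
Qed.

Theorem theorem2p1 (p q l n : nat)
    (p_gt0 : 0 < p) (q_gt0 : 0 < q) (l_gt0 : 0 < l) (n_gt0 : 0 < n)
    (le_pq : p <= q) (le_ql : q <= l) (gcd_pql : gcdn (gcdn p q) l = 1) :
  let u := gcdn p q in
  let d (j : nat) : int := (n%:Z - (j * l)%:Z)%R in
  (exists2 j : nat, j < u & (d j = 0 %[mod u])%Z) /\
  (forall j : nat, j < u -> (d j = 0 %[mod u])%Z ->
     N p q l n =
     sum_upto (d j %/ (u * l)%:Z)%Z
       (fun k => pA (p %/ u) (q %/ u) ((d j %/ u)%Z - (l * k)%:Z)%R)).
Proof.
move=> u d.
have u0 : 0 < u by rewrite gcdn_gt0 p_gt0.
have ul : coprime u l by apply/eqP.
have up : u %| p by rewrite dvdn_gcdl.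
have uq : u %| q by rewrite dvdn_gcdr.
have pE : p = u * (p %/ u) by rewrite mulnC divnK.
have qE : q = u * (q %/ u) by rewrite mulnC divnK.
have pu0 : 0 < p %/ u by rewrite divn_gt0 // dvdn_leq.
have qu0 : 0 < q %/ u by rewrite divn_gt0 // dvdn_leq.
split=> [|j ju /dvdz_sub_mod jn].
  by have [j ju jn] := mod_solution u l n u0 ul; exists j => //; apply/dvdz_sub_mod.
have NE : N p q l n = \sum_(z < n.+1 | (l * z <= n) && (z == j %[mod u]))
    box_count p q n.+1 (n - l * z).
  rewrite N_sum [RHS]big_mkcondr /=; apply: eq_bigr => z zn.
  rewrite -(@dvdn_sub_mod u l n) //; case: ifP => // /negbT.
  exact: box_count_ndvd.
have zE (z : nat) : z = j %[mod u] -> z = j + u * (z %/ u).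
  by rewrite (modn_small ju) => zj; rewrite {1}(divn_eq z u) zj mulnC addnC.
rewrite NE; case: (leqP (j * l) n) => jln; last first.
  (* Integer division rounds down, so the upper limit is negative and [sum_upto] returns 0. On the
     left, [z >= j] forces [l * z > n], so no term remains. *)
  have : ((d j %/ (u * l)%:Z)%Z < 0)%R by rewrite ltz_divLR ?mul0r /d; nia.
  case: (_ %/ _)%Z => // m _ /=.
  rewrite big1 // => z /andP[zn /eqP/zE zj]; move: jln; rewrite ltnNge.
  by rewrite (leq_trans _ zn) // mulnC leq_mul2l zj leq_addr orbT.
have dE : d j = Posz (n - j * l) by rewrite /d subzn.
have /dvdnP[M ME] : u %| n - j * l by rewrite -eqn_mod_dvd // jn.
rewrite dE !divz_nat ME [u * l]mulnC mulnK // divnMr //.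
rewrite /sum_upto big_mkord.
have kP (k : 'I_(M %/ l).+1) : l * k <= M.
  by rewrite mulnC -leq_divRL // -ltnS.
have kn (k : 'I_(M %/ l).+1) : l * (j + u * k) <= n.
  by have := kP k; nia.
have hlt (k : 'I_(M %/ l).+1) : j + u * k < n.+1.
  by have := kn k; nia.
(* Substitute [z = j + u * k]; since [j < u], the inverse is [k = z %/ u]. By [hlt] and [zM],
   [inord] never takes its default value. *)
rewrite (reindex_onto (fun k : 'I_(M %/ l).+1 => inord (j + u * k) : 'I_n.+1)
                      (fun z => inord (z %/ u))) /=; last first.
  move=> z /andP[zn /eqP/zE zj]; apply: val_inj => /=.
  have zM : z %/ u < (M %/ l).+1 by rewrite ltnS leq_divRL //; nia.
  by rewrite !inordK // -zj.
apply: eq_big => [k|k _].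
  rewrite inordK ?hlt // kn [j + _]addnC [u * _]mulnC modnMDl eqxx /=.
  apply/eqP/val_inj.
  by rewrite divnMDl // (divn_small ju) addn0 /= inordK.
rewrite inordK ?hlt // subzn // pA_box_count.
(* Bring the right side to the box of [N], then multiply its equation by [u]:
   [u * (M - l * k) = n - l * (j + u * k)]. *)
rewrite -[RHS](@box_count_widen _ _ n.+1) //; last by nia.
rewrite -[RHS](@box_count_scale u) // -pE -qE; congr box_count.
have := kP k; have := kn k; nia.
Qed.
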